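(* Let $n>2$ and $q>2$. Then there exists an orientable sequence of order $n$ over $\mathbb{Z}_q$ with period at least \[ \begin{cases} q\bigl(q^{n-1}-r_{q,n-1,(n-1)q/2}-2\bigr)/2 & \text{if } q\neq 6,\\ q\bigl(q^{n-1}-r_{q,n-1,(n-1)q/2}-4\bigr)/2 & \text{if } q=6, \end{cases} \] where $r_{q,k,s}$ denotes the number of $q$-ary $k$-tuples with pseudoweight exactly $s$.
   Context: Sequences are periodic with entries in $\mathbb{Z}_q$. For a sequence $S=(s_i)$ write $\mathbf{s}_n(i)=(s_i,\ldots,s_{i+n-1})$, and for an $n$-tuple $\mathbf{u}=(u_0,\ldots,u_{n-1})$ let $\mathbf{u}^R=(u_{n-1},\ldots,u_0)$. A periodic sequence $S$ of period $m$ is an $n$-window sequence if $\mathbf{s}_n(i)=\mathbf{s}_n(j)$ implies $i\equiv j\pmod m$; it is an orientable sequence of order $n$ if moreover $\mathbf{s}_n(i)\neq\mathbf{s}_n(j)^R$ for all $i,j$. Pseudoweight: define $f:\mathbb{Z}_q\to\mathbb{Q}$ by treating $u\in\mathbb{Z}_q$ as an integer in $[0,q-1]$ and setting $f(u)=u$ if $u\neq 0$ and $f(0)=q/2$. The pseudoweight of a tuple $(u_0,\ldots,u_{k-1})$ is $\sum_{i=0}^{k-1} f(u_i)$ computed in $\mathbb{Q}$. *)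

(* Defs.v *)
From mathcomp Require Import all_boot all_order all_algebra.

Set Implicit Arguments.
Unset Strict Implicit.
Unset Printing Implicit Defensive.

Import Order.TTheory GRing.Theory Num.Theory.
Local Open Scope ring_scope.

(* The type 'Z_q is the ring of integers mod q, with representatives in
   [0, q-1], only when 1 < q. *)

Definition window (q n : nat) (s : nat -> 'Z_q) (i : nat) : n.-tuple 'Z_q :=
  [tuple s (i + k)%N | k < n].

Definition rev_window (q n : nat) (u : n.-tuple 'Z_q) : n.-tuple 'Z_q :=
  [tuple of rev u].

Definition periodic (q m : nat) (s : nat -> 'Z_q) : Prop :=
  (0 < m)%N /\ forall i : nat, s (i + m)%N = s i.

(* The window condition forces m to be the least period of s. *)
Definition window_sequence (q n m : nat) (s : nat -> 'Z_q) : Prop :=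
  periodic m s /\
  forall i j : nat, window n s i = window n s j -> (i = j %[mod m])%N.

Definition orientable_sequence (q n m : nat) (s : nat -> 'Z_q) : Prop :=
  window_sequence n m s /\
  forall i j : nat, window n s i <> rev_window (window n s j).

Definition pseudoval (q : nat) (u : 'Z_q) : rat :=
  if u == 0 then q%:R / 2%:R else (nat_of_ord u)%:R.

Definition pseudoweight (q k : nat) (u : k.-tuple 'Z_q) : rat :=
  \sum_(i < k) pseudoval (tnth u i).

Definition num_pseudoweight (q k : nat) (s : rat) : nat :=
  #|[set u : k.-tuple 'Z_q | pseudoweight u == s]|.

(* Main.v *)
Require Import Defs.
From mathcomp Require Import all_boot all_order all_fingroup all_algebra.
From mathcomp Require Import zify lra.

Set Implicit Arguments.
Unset Strict Implicit.
Unset Printing Implicit Defensive.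

Import Order.TTheory GRing.Theory Num.Theory.
Local Open Scope ring_scope.

(* Put k = n - 1 and centre the pseudoweight so that negating an entry negates
   its value. The k-tuples of negative centred weight are closed under rotation,
   so, as edges of the de Bruijn graph, they form a balanced graph; it is
   connected, and an Eulerian circuit gives a sequence t whose windows are
   exactly these tuples. None of them is the negated reverse of another, so the
   sequence of partial sums of t is orientable of order n, and its period is q
   times that of t as soon as the sum of t over a period is a unit mod q. This
   is arranged by deleting constant tuples (a, ..., a) with 0 < a < q/2, that
   is, loops of the graph: units are dense enough mod q for one deletion to
   suffice, except that q = 6 may require two. *)

(** * Eulerian circuits in the de Bruijn graph *)

(** Tuples are edges: [behead u] is the vertex where the edge [u] ends, [take k v] the one where [v]
    starts. *)
Definition debruijn_step (T : eqType) (k : nat) (u v : k.+1.-tuple T) : bool :=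
  take k v == behead u.

Lemma debruijn_step_rot1 (T : eqType) (k : nat) (u : k.+1.-tuple T) :
  debruijn_step u [tuple of rot 1 u].
Proof.
rewrite /debruijn_step /=; case/tupleP: u => x u /=.
by rewrite rot1_cons -cats1 take_size_cat // size_tuple.
Qed.

(** Strong connectivity of [E], phrased by closed subsets to avoid paths. *)
Definition debruijn_connected (T : finType) (k : nat)
    (E : {set k.+1.-tuple T}) : Prop :=
  forall C : {set k.+1.-tuple T}, C \subset E -> C != set0 ->
    (forall u v, u \in C -> v \in E -> debruijn_step u v -> v \in C) ->
    E \subset C.

(** The circuit is encoded as a permutation of all edges that has [E] as a cycle. Rotation
    invariance plays the part of balance: rotation itself is a first permutation that follows edges
    and preserves [E]. *)
Lemma debruijn_eulerian (T : finType) (k : nat) (E : {set k.+1.-tuple T}) :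
  (forall u : k.+1.-tuple T, ([tuple of rot 1 u] \in E) = (u \in E)) ->
  debruijn_connected E ->
  exists s : {perm k.+1.-tuple T},
    (forall u, debruijn_step u (s u)) /\ (forall u, u \in E -> porbit s u = E).
Proof.
move=> rotE connE.
have rot_injT : injective (fun u : k.+1.-tuple T => [tuple of rot 1 u]).
  by move=> u v /(congr1 val) /= /rot_inj /val_inj.
pose P (s : {perm k.+1.-tuple T}) :=
  [forall u, debruijn_step u (s u) && ((s u \in E) == (u \in E))].
have P0 : P (perm rot_injT).
  by apply/forallP=> u; rewrite permE debruijn_step_rot1 rotE eqxx.
(* Among the successor permutations, one with the fewest cycles has all edges
   with a common endpoint in one cycle: a transposition would merge two. *)
have [s /forallP Ps s_min] := arg_minnP (fun s : {perm _} => #|porbits s|) P0.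
have sS u : debruijn_step u (s u) by case/andP: (Ps u).
have sE u : (s u \in E) = (u \in E) by case/andP: (Ps u) => _ /eqP.
exists s; split=> // u uE.
have same_orbit x y : x \in E -> y \in E -> behead x = behead y ->
    x \in porbit s y.
  move=> xE yE xy; apply/contraT => nxy.
  have : P (tperm x y * s)%g.
    apply/forallP=> z; rewrite permM sE.
    case: tpermP => [->|->|_ _]; rewrite ?xE ?yE ?eqxx ?andbT //.
    - by rewrite /debruijn_step xy; apply: sS.
    - by rewrite /debruijn_step -xy; apply: sS.
  move/s_min; have := porbits_mul_tperm s x y.
  rewrite /= nxy /= => eq_card le_card.
  have : (#|porbits s| + 2 <= #|porbits s| + 1)%N.
    by rewrite (leq_trans (leq_add le_card (leqnn 2))) // eq_card leq_add2l leq_b1.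
  by rewrite leq_add2l.
have orbE v : (v \in porbit s u) -> v \in E.
  case/porbitP=> i ->; elim: i => [|i IH]; first by rewrite expg0 perm1.
  by rewrite expgSr permM sE.
apply/eqP; rewrite eqEsubset; apply/andP; split; first by apply/subsetP.
apply: connE.
- by apply/subsetP.
- by apply/set0Pn; exists u; apply: porbit_id.
(* The predecessor of [y] under [s] ends at the same vertex as [x], so it lies in the cycle of [x],
   and [y] with it. *)
move=> x y xu yE /eqP xy.
have [z def_y] : exists z, y = s z by exists (s^-1%g y); rewrite permKV.
have zE : z \in E by rewrite -sE -def_y.
have := sS z; rewrite -def_y /debruijn_step xy => /eqP xz.
have zx := same_orbit _ _ zE (orbE _ xu) (esym xz).
have -> : porbit s u = porbit s y.
  rewrite def_y -[s z]/((aperm z s)) -[s in aperm z s]expg1 porbit_perm.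
  by move: zx xu; rewrite -!eq_porbit_mem => /eqP -> /eqP ->.
exact: porbit_id.
Qed.

(** * Units modulo q within distance q/2 *)

(** The unit is -1 for [w = 0], 1 for [w] up to q/2, and otherwise one close to q/2, chosen
    according to q modulo 4. *)
Lemma exists_coprime_shift (q w : nat) : (2 < q)%N -> q != 6%N -> (w < q)%N ->
  exists a v : nat,
    [/\ (a.*2 < q)%N, coprime q v & (v + a = w \/ v + a = w + q)%N].
Proof.
move=> q_gt2 q_neq6 w_lt_q.
have [w0|w_gt0] := posnP w.
  exists 1%N, q.-1; split; [lia| |lia].
  rewrite coprime_sym; case: q q_gt2 {q_neq6 w_lt_q} => //= q _.
  exact: coprimenS.
have [w_small|w_big] := leqP w.*2 q.
  by exists w.-1, 1%N; split; [lia | rewrite coprimen1 | lia].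
have [q_odd|q_even] := boolP (odd q).
  exists (w - q./2.+1)%N, q./2.+1; split; [lia| |lia].
  have def_q : q = (q./2.+1 + q./2)%N by lia.
  rewrite {1}def_q coprime_sym /coprime gcdnDl -/(coprime _ _) coprime_sym.
  exact: coprimenS.
have def_q : q = (2 * q./2)%N by lia.
have [h_odd|h_even] := boolP (odd q./2); last first.
  exists (w - q./2.+1)%N, q./2.+1; split; [lia| |lia].
  rewrite {1}def_q coprimeMl coprime2n coprimenS andbT /=; exact: h_even.
have coprime_step (h : nat) : odd h -> coprime h (h + 2).
  by move=> ho; rewrite /coprime gcdnDl -/(coprime _ _) coprimen2.
(* With h = q/2 odd, none of h + 1, h, h - 1 is a unit, so [w = h + 1] has to descend by 3 to h - 2.
   This needs 3 < h, which fails exactly for q = 6. *)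
have [w_eq|w_neq] := eqVneq w q./2.+1.
  exists 3%N, (q./2 - 2)%N; split; [lia| |lia].
  have h_ge2 : (2 <= q./2)%N by lia.
  rewrite {1}def_q coprimeMl coprime2n; apply/andP; split; first by lia.
  have /coprime_step : odd (q./2 - 2) by lia.
  by rewrite subnK // coprime_sym.
exists (w - (q./2 + 2))%N, (q./2 + 2)%N; split; [lia| |lia].
rewrite {1}def_q coprimeMl coprime2n coprime_step // andbT; lia.
Qed.

(** * Sequences read off Eulerian circuits, and their partial sums *)

Lemma nth_window (q n : nat) (s : nat -> 'Z_q) (i x : nat) :
  (x < n)%N -> nth 0 (window n s i) x = s (i + x)%N.
Proof.
by move=> lt_xn; rewrite -(tnth_nth 0 _ (Ordinal lt_xn)) tnth_mktuple.
Qed.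

(** The sequence lists the first entries of the edges along the circuit. Each edge is met once per
    period, which turns the sum over a period into a sum over [E]. *)
Lemma debruijn_sequence (q k : nat) (E : {set k.+1.-tuple 'Z_q}) :
  (forall u : k.+1.-tuple 'Z_q, ([tuple of rot 1 u] \in E) = (u \in E)) ->
  debruijn_connected E -> E != set0 ->
  exists t : nat -> 'Z_q,
    [/\ window_sequence k.+1 #|E| t, forall i, window k.+1 t i \in E
      & \sum_(i < #|E|) t i = \sum_(u in E) thead u].
Proof.
move=> rotE connE /set0Pn[u0 u0E].
have [s [s_step s_orbit]] := debruijn_eulerian rotE connE.
have orbE : porbit s u0 = E := s_orbit _ u0E.
have nth_iter j : forall i u, (i + j < k.+1)%N ->
    nth 0 (iter j s u) i = nth 0 u (i + j).
  elim: j => [|j IH] i u ijk; first by rewrite addn0.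
  rewrite iterS addnS -addSn -IH ?addSnnS //.
  have /eqP/(congr1 (nth 0 ^~ i)) := s_step (iter j s u).
  by rewrite nth_behead nth_take //; lia.
pose t i := thead (iter i s u0).
have winE i : window k.+1 t i = iter i s u0.
  apply: eq_from_tnth => x; rewrite tnth_mktuple /t /thead !(tnth_nth 0).
  by rewrite addnC iterD nth_iter add0n ?ltn_ord.
have card_gt0 : (0 < #|E|)%N by apply/card_gt0P; exists u0.
have iterE : iter #|E| s u0 = u0 by rewrite -orbE iter_porbit.
have iter_mul c : iter (c * #|E|) s u0 = u0.
  by elim: c => // c IH; rewrite mulSn iterD IH.
have iter_mod i : iter i s u0 = iter (i %% #|E|) s u0.
  by rewrite {1}(divn_eq i #|E|) addnC iterD iter_mul.
have uniqE : uniq (traject s u0 #|E|) by rewrite -orbE uniq_traject_porbit.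
exists t; split; first split; first split=> //.
- by move=> i; rewrite /t iterD iterE.
- move=> i j; rewrite !winE iter_mod (iter_mod j).
  have ltE x : (x %% #|E| < #|E|)%N by rewrite ltn_mod.
  rewrite -(nth_traject s (ltE i)) -(nth_traject s (ltE j)) => /eqP.
  by rewrite nth_uniq ?size_traject // => /eqP.
- move=> i; rewrite winE -orbE.
  by have := mem_porbit s i u0; rewrite permX.
have -> : \sum_(u in E) thead u = \sum_(u <- traject s u0 #|E|) thead u.
  rewrite (big_uniq _ uniqE); apply: eq_bigl => u.
  by rewrite -{1}orbE porbit_traject orbE.
rewrite (big_nth u0) size_traject big_mkord; apply: eq_bigr => i _.
by rewrite nth_traject.
Qed.

(* The partial sums of t invert the difference map, under which reversing
   a window becomes reversing and negating it. *)
Lemma lift_orientable (q k m : nat) (t : nat -> 'Z_q) :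
  (1 < q)%N -> window_sequence k m t ->
  (forall i j, exists2 x, (x < k)%N & t (i + x)%N != - t (j + (k - x.+1))%N) ->
  \sum_(i < m) t i \is a GRing.unit ->
  orientable_sequence k.+1 (q * m) (fun i => \sum_(j < i) t j).
Proof.
move=> q_gt1 [[m_gt0 per_t] win_t] neg_t; set w := \sum_(i < m) t i => w_unit.
set s := fun i : nat => \sum_(j < i) t j.
have sS i : s i.+1 = s i + t i by rewrite /s big_ord_recr.
have s_m i : s (i + m)%N = s i + w.
  elim: i => [|i IH]; first by rewrite /s big_ord0 add0r.
  by rewrite addSn !sS IH per_t addrAC.
have s_cm c i : s (i + c * m)%N = s i + w *+ c.
  elim: c => [|c IH]; first by rewrite mul0n addn0 mulr0n addr0.
  by rewrite mulSn addnCA addnC s_m IH mulrSr addrA.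
split; first split; first split.
- by rewrite muln_gt0 m_gt0 andbT; lia.
- by move=> i; rewrite s_cm -mulr_natr pchar_Zp // mulr0 addr0.
- have main i j : (i <= j)%N -> window k.+1 s i = window k.+1 s j ->
      (i = j %[mod q * m])%N.
    move=> le_ij eq_ij.
    have eq_s x : (x < k.+1)%N -> s (i + x)%N = s (j + x)%N.
      by move=> ltx; rewrite -!(nth_window _ _ ltx) eq_ij.
    have /win_t/eqP : window k t i = window k t j.
      apply: eq_from_tnth => x; rewrite !tnth_mktuple.
      apply: (@addrI _ (s (i + x)%N)); rewrite -sS eq_s; last first.
        exact: (ltn_trans (ltn_ord x)).
      by rewrite -sS -!addnS; apply: eq_s; rewrite ltnS.
    (* Now [j = i + c * m], and equality of [s i] and [s j] gives [c * w = 0]; as [w] is a unit, [q]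
       divides [c]. *)
    rewrite eq_sym eqn_mod_dvd // => /dvdnP[c def_c].
    have def_j : j = (i + c * m)%N by rewrite -def_c subnKC.
    have := eq_s 0%N isT; rewrite !addn0 def_j s_cm => /eqP.
    rewrite -subr_eq0 opprD addNKr oppr_eq0 -mulr_natl mulIr_eq0; last exact: mulIr.
    move/eqP/(congr1 (@nat_of_ord _)); rewrite val_Zp_nat //= => c0.
    by rewrite (divn_eq c q) c0 addn0 -mulnA addnC modnMDl.
  move=> i j; case: (leqP i j) => [le_ij|/ltnW le_ji] eq_ij; first exact: main.
  exact/esym/main.
move=> i j eq_ij.
(* Differences of neighbouring entries of a reversed window are negated differences in reverse
   order; there are only [k] of them, hence the mirror index [k - x.+1]. *)
have eq_s x : (x < k.+1)%N -> s (i + x)%N = s (j + (k - x))%N.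
  move=> ltx; rewrite -(nth_window _ _ ltx) eq_ij.
  rewrite -[tval (rev_window _)]/(rev (window k.+1 s j)) nth_rev size_tuple //.
  by rewrite subSS nth_window // ltnS leq_subr.
have [x ltx /eqP[]] := neg_t i j.
apply: (@addrI _ (s (i + x)%N)); rewrite -sS -addnS !eq_s //; last exact: ltnW.
have -> : (k - x = (k - x.+1).+1)%N by lia.
by rewrite addnS sS addrK.
Qed.

(** * Centred weights *)

Definition centred_val (q : nat) (x : 'Z_q) : rat := pseudoval x - q%:R / 2%:R.

Lemma centred_val0 (q : nat) : centred_val (0 : 'Z_q) = 0.
Proof. by rewrite /centred_val /pseudoval eqxx subrr. Qed.

(** Representatives of nonzero [x] and [- x] add up to [q]; the value q/2 given to 0 makes 0 fit the
    same rule. *)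
Lemma centred_valN (q : nat) (x : 'Z_q) :
  (1 < q)%N -> centred_val (- x) = - centred_val x.
Proof.
move=> q_gt1; rewrite /centred_val /pseudoval oppr_eq0.
have [_|x_neq0] := eqVneq x 0; first by rewrite subrr oppr0.
have x_lt : (x < q)%N by have := ltn_ord x; rewrite {2}(Zp_cast q_gt1).
have x_gt0 : (0 < x)%N.
  by rewrite lt0n; apply: contra x_neq0 => /eqP x0; apply/eqP/val_inj.
have -> : nat_of_ord (- x) = (q - x)%N.
  rewrite /=; move: (nat_of_ord x) x_lt x_gt0 => y y_lt y_gt0.
  by rewrite (Zp_cast q_gt1) modn_small //; lia.
rewrite natrB 1?ltnW //; lra.
Qed.

Lemma centred_val_nat (q a : nat) : (0 < a < q)%N ->
  centred_val (a%:R : 'Z_q) = a%:R - q%:R / 2%:R.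
Proof.
case/andP=> a_gt0 a_lt; have q_gt1 : (1 < q)%N by lia.
have val_a : nat_of_ord (a%:R : 'Z_q) = a by rewrite val_Zp_nat // modn_small.
rewrite /centred_val /pseudoval val_a; case: eqP => // a0.
by move: a_gt0; rewrite -val_a a0.
Qed.

Lemma centred_val1 (q : nat) : (1 < q)%N ->
  centred_val (1 : 'Z_q) = 1 - q%:R / 2%:R.
Proof. by move=> q_gt1; rewrite -(@centred_val_nat q 1). Qed.

Lemma centred_val1_lt0 (q : nat) : (2 < q)%N -> centred_val (1 : 'Z_q) < 0.
Proof.
move=> q_gt2; rewrite centred_val1 1?ltnW //.
have : (2%:R : rat) < q%:R by rewrite ltr_nat.
lra.
Qed.

(** Since 0 counts as q/2, the lightest entry is 1, so replacing an entry by 1 keeps the weight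
    negative. *)
Lemma centred_val1_le (q : nat) (x : 'Z_q) : (2 < q)%N ->
  centred_val (1 : 'Z_q) <= centred_val x.
Proof.
move=> q_gt2; have [->|x_neq0] := eqVneq x 0.
  by rewrite centred_val0 ltW // centred_val1_lt0.
rewrite centred_val1 1?ltnW // /centred_val /pseudoval (negPf x_neq0) lerD2r.
rewrite (ler_nat _ 1) lt0n; apply: contra x_neq0 => /eqP x0.
exact/eqP/val_inj.
Qed.

Definition centred_weight (q : nat) (u : seq 'Z_q) : rat :=
  \sum_(x <- u) centred_val x.

Lemma centred_weightE (q k : nat) (u : k.-tuple 'Z_q) :
  centred_weight u = pseudoweight u - k%:R * q%:R / 2%:R.
Proof.
rewrite /centred_weight big_tuple /pseudoweight sumrB sumr_const card_ord.
by rewrite -[_ *+ k]mulr_natl mulrA.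
Qed.

Lemma centred_weightN (q : nat) (u : seq 'Z_q) : (1 < q)%N ->
  centred_weight (map -%R u) = - centred_weight u.
Proof.
move=> q_gt1; rewrite /centred_weight big_map -sumrN.
by apply: eq_bigr => x _; rewrite centred_valN.
Qed.

(** * Light tuples and their connectivity *)

(** Plain sequences can be split and joined freely in the connectivity proof. [A] holds the values
    whose constant tuples are deleted. *)
Definition light_seq (q k : nat) (A : {set 'Z_q}) : pred (seq 'Z_q) :=
  fun u => [&& size u == k, centred_weight u < 0
             & [forall a in A, u != nseq k a]].

Definition light_tuples (q k : nat) (A : {set 'Z_q}) : {set k.-tuple 'Z_q} :=
  [set u : k.-tuple 'Z_q | light_seq k A u].

Lemma perm_light_seq (q k : nat) (A : {set 'Z_q}) (u v : seq 'Z_q) :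
  perm_eq u v -> light_seq k A u = light_seq k A v.
Proof.
move=> uv; rewrite /light_seq (perm_size uv).
have -> : centred_weight u = centred_weight v by apply: perm_big.
case: eqP => //= szv; congr (_ && _); apply: eq_forallb => a.
congr (_ ==> ~~ _); rewrite -{1}szv -{1}(perm_size uv) -szv.
by apply/eqP/eqP => /all_pred1P; [rewrite (perm_all _ uv)|rewrite -(perm_all _ uv)];
  move/all_pred1P.
Qed.

Lemma light_tuples_rot1 (q k : nat) (A : {set 'Z_q}) (u : k.-tuple 'Z_q) :
  ([tuple of rot 1 u] \in light_tuples k A) = (u \in light_tuples k A).
Proof. by rewrite !inE; apply: perm_light_seq; rewrite perm_rot. Qed.

Lemma light_seq_mixed (q k : nat) (A : {set 'Z_q}) (x y : 'Z_q) (u : seq 'Z_q) :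
  size u = k -> centred_weight u < 0 -> x \in u -> y \in u -> x != y ->
  light_seq k A u.
Proof.
move=> szu wu xu yu xy; rewrite /light_seq szu eqxx wu /=.
apply/forall_inP=> a _; apply: contraNneq xy => def_u.
by move: xu yu; rewrite def_u !mem_nseq => /andP[_ /eqP->] /andP[_ /eqP->].
Qed.

(* Lowering the entries to 1 one at a time leads every light tuple to a
   rotation of (0, 1, ..., 1), which is never constant. *)
Lemma light_tuples_connected (q k : nat) (A : {set 'Z_q}) :
  (2 < q)%N -> (0 < k)%N -> debruijn_connected (light_tuples k.+1 A).
Proof.
move=> q_gt2 k_gt0 C /subsetP C_sub /set0Pn[u0 u0C] C_step.
pose L := light_seq k.+1 A; pose D (u : seq 'Z_q) := [exists v in C, val v == u].
have DL u : D u -> L u.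
  by case/exists_inP=> v /C_sub vL /eqP <-; rewrite inE in vL.
have Dval (u : k.+1.-tuple 'Z_q) : D u = (u \in C).
  apply/exists_inP/idP => [[v vC /eqP/val_inj <-]|uC] //.
  by exists u.
have D_step x a y : D (x :: a) -> L (rcons a y) -> D (rcons a y).
  move=> /exists_inP[u uC /eqP def_u] Ly.
  have szy : size (rcons a y) == k.+1 by case/and3P: Ly.
  rewrite -[rcons a y]/(val (Tuple szy)) Dval; apply: C_step uC _ _.
    by rewrite inE.
  rewrite /debruijn_step /= def_u /= -cats1 take_size_cat //.
  by move: szy; rewrite size_rcons eqSS => /eqP.
have D_rot a : forall b, D (a ++ b) -> D (b ++ a).
  elim: a => [|x a IH] b; first by rewrite cats0.
  rewrite cat_cons => Dab; rewrite -cat_rcons; apply: IH.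
  rewrite -rcons_cat; apply: D_step (Dab) _.
  by rewrite /L (@perm_light_seq _ _ _ _ (x :: (a ++ b))) ?perm_rcons //; apply: DL.
(* A step drops the first entry and appends a new one, so together with rotations it exchanges any
   single entry, as long as the result is light. *)
have D_set_imp a x y b : L (a ++ y :: b) -> D (a ++ x :: b) -> D (a ++ y :: b).
  move=> Ly /D_rot /= Dx; rewrite -cat_rcons; apply: D_rot.
  rewrite -rcons_cat; apply: D_step Dx _.
  rewrite /L -(@perm_light_seq _ _ _ (a ++ y :: b)) // rcons_cat -cats1.
  by rewrite perm_sym perm_catC -catA.
have D_set a x y b : L (a ++ x :: b) -> L (a ++ y :: b) ->
    D (a ++ x :: b) = D (a ++ y :: b).
  by move=> Lx Ly; apply/idP/idP; apply: D_set_imp.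
pose z : seq 'Z_q := 0 :: nseq k 1.
have w1 := centred_val1_lt0 q_gt2.
have one_neq0 : (1 : 'Z_q) != 0 by apply: oner_neq0.
have Lz : L z.
  apply: (@light_seq_mixed _ _ _ 1 0) => //.
  - by rewrite /= size_nseq.
  - rewrite /centred_weight big_cons centred_val0 add0r big_nseq.
    by rewrite iter_addr_0 pmulrn_llt0.
  - by rewrite /z in_cons mem_nseq k_gt0 eqxx orbT.
(* Induction on the number of entries other than 1. While there are two, one is lowered to 1 and the
   other keeps the tuple mixed. A single one becomes 0 instead, since the tuple of ones may have
   been deleted. *)
have D_z d : forall u, count (predC1 1) u = d -> L u -> D u = D z.
  elim: d => [|d IH] u cu Lu; have szu : size u = k.+1 by case/and3P: (Lu) => /eqP.
    have def_u : u = 1 :: nseq k 1.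
      rewrite -[RHS]/(nseq k.+1 1) -szu; apply/all_pred1P.
      by rewrite -[all _ _]negbK -has_predC has_count cu.
    by rewrite def_u; apply: (D_set [::]); rewrite //= -def_u.
  have /hasP[x xu /= x_neq1] : has (predC1 1) u by rewrite has_count cu.
  case/splitPr: xu cu Lu szu => a b cu Lu szu.
  have szab : size (a ++ b) = k.
    by move: szu; rewrite !size_cat /= addnS => -[].
  have cab : count (predC1 1) (a ++ b) = d.
    by move: cu; rewrite !count_cat /= x_neq1 addnCA add1n => -[].
  case: d cab cu IH => [|d] cab cu IH.
    have ba1 : b ++ a = nseq k 1.
      rewrite -szab size_cat addnC -size_cat; apply/all_pred1P.
      rewrite -[all _ _]negbK -has_predC has_count count_cat addnC -count_cat.
      by rewrite cab.
    have L0 : L (a ++ 0 :: b).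
      by rewrite /L (@perm_light_seq _ _ _ _ z) // perm_catC cat_cons ba1.
    rewrite (D_set a x 0 b Lu L0) /z -ba1 -cat_cons.
    by apply/idP/idP; apply: D_rot.
  have [y yab /= y_neq1] : exists2 y, y \in a ++ b & (predC1 1) y.
    by apply/hasP; rewrite has_count cab.
  have L1 : L (a ++ 1 :: b).
    apply: (@light_seq_mixed _ _ _ y 1) => //.
    - by rewrite -szu !size_cat.
    - case/and3P: Lu => _ wu _; apply: le_lt_trans wu.
      rewrite /centred_weight !big_cat !big_cons /= lerD2l lerD2r.
      exact: centred_val1_le.
    - by move: yab; rewrite !mem_cat inE => /orP[->|->]; rewrite ?orbT.
    - by rewrite mem_cat inE eqxx orbT.
  rewrite (D_set a x 1 b Lu L1); apply: IH L1.
  by rewrite -cab !count_cat /=.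
have Du0 : D u0 by rewrite Dval.
apply/subsetP=> u; rewrite inE => Lu.
by rewrite -Dval (D_z _ _ erefl Lu) -(D_z _ _ erefl (DL _ Du0)).
Qed.

(** * Counts and sums of light tuples *)

(** Negating all entries matches negative weights with positive ones; what remains has centred
    weight zero, that is, pseudoweight kq/2. *)
Lemma card_light_tuples0 (q k : nat) : (1 < q)%N ->
  (2 * #|light_tuples (q := q) k set0|
     + num_pseudoweight q k (k%:R * q%:R / 2%:R) = q ^ k)%N.
Proof.
move=> q_gt1.
have lightE (u : k.-tuple 'Z_q) :
    (u \in light_tuples k set0) = (centred_weight u < 0).
  rewrite inE /light_seq size_tuple eqxx /=.
  by case: (_ < 0) => //=; apply/forall_inP=> a; rewrite inE.
pose opp_tuple (u : k.-tuple 'Z_q) := [tuple of map -%R u].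
have opp_tupleK : involutive opp_tuple.
  by move=> u; apply: val_inj; rewrite /= mapK //; apply: opprK.
have card_pos : #|[set u : k.-tuple 'Z_q | 0 < centred_weight u]|
    = #|light_tuples (q := q) k set0|.
  rewrite -(card_imset _ (inv_inj opp_tupleK)); apply: eq_card => u.
  rewrite lightE; apply/imsetP/idP => [[v]|wu].
    by rewrite inE => wv ->; rewrite centred_weightN // oppr_lt0.
  exists (opp_tuple u); last by rewrite opp_tupleK.
  by rewrite inE centred_weightN // oppr_gt0.
have card_zero : #|[set u : k.-tuple 'Z_q | centred_weight u == 0]|
    = num_pseudoweight q k (k%:R * q%:R / 2%:R).
  by apply: eq_card => u; rewrite !inE centred_weightE subr_eq0.
have card_all : #|{: k.-tuple 'Z_q}| = (q ^ k)%N.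
  by rewrite card_tuple card_ord Zp_cast.
rewrite -card_all -cardsT mul2n -addnn -{1}card_pos -card_zero.
rewrite -(cardsID [set u : k.-tuple 'Z_q | 0 < centred_weight u] setT) setTI.
rewrite -addnA; congr (_ + _)%N.
rewrite -(cardsID (light_tuples k set0)
            (setT :\: [set u : k.-tuple 'Z_q | 0 < centred_weight u])).
congr (_ + _)%N; apply: eq_card => u; rewrite !inE.
  by move: (lightE u); rewrite inE => ->; case: ltgtP.
by move: (lightE u); rewrite inE => ->; case: ltgtP.
Qed.

Lemma light_tuplesD (q k : nat) (A : {set 'Z_q}) :
  light_tuples k A =
  light_tuples k set0 :\: [set [tuple of nseq k a] | a in A].
Proof.
apply/setP=> u; rewrite !inE /light_seq size_tuple eqxx /=.
have -> : [forall a in set0, val u != nseq k a] = true.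
  by apply/forall_inP=> a; rewrite inE.
rewrite andbT andbC; congr (_ && _).
apply/forall_inP/negP => [uA /imsetP[a aA def_u]|uA a aA].
  by have := uA a aA; rewrite def_u eqxx.
by apply/eqP => def_u; case: uA; apply/imsetP; exists a => //; apply: val_inj.
Qed.

Lemma const_tuple_inj (T : Type) (k : nat) :
  injective (fun a : T => [tuple of nseq k.+1 a]).
Proof. by move=> a b /(congr1 val) /= []. Qed.

Lemma const_tuples_light (q k : nat) (A : {set 'Z_q}) :
  (forall a, a \in A -> centred_val a < 0) ->
  [set [tuple of nseq k.+1 a] | a in A] \subset light_tuples k.+1 set0.
Proof.
move=> A_neg; apply/subsetP=> _ /imsetP[a aA ->].
rewrite inE /light_seq /= size_nseq eqxx /=.
apply/andP; split; last by apply/forall_inP=> b; rewrite inE.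
rewrite /centred_weight -[a :: _]/(nseq k.+1 a) big_nseq iter_addr_0.
by rewrite pmulrn_llt0 // A_neg.
Qed.

Lemma card_light_tuples_removal (q k : nat) (A : {set 'Z_q}) :
  (forall a, a \in A -> centred_val a < 0) ->
  (#|light_tuples k.+1 A| + #|A| = #|light_tuples (q := q) k.+1 set0|)%N.
Proof.
move=> /(@const_tuples_light _ k) B_sub.
have <- : #|[set [tuple of nseq k.+1 a] | a in A]| = #|A|.
  exact: card_imset (@const_tuple_inj _ k).
rewrite light_tuplesD addnC -[RHS](cardsID [set [tuple of nseq k.+1 a] | a in A]).
by rewrite (setIidPr B_sub).
Qed.

(** The deleted tuple (a, ..., a) contributes its first entry a, so the choice of [A] steers the sum
    over a period. *)
Lemma sum_light_tuples_removal (q k : nat) (A : {set 'Z_q}) :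
  (forall a, a \in A -> centred_val a < 0) ->
  \sum_(u in light_tuples k.+1 A) thead u
    = \sum_(u in light_tuples (q := q) k.+1 set0) thead u - \sum_(a in A) a.
Proof.
move=> /(@const_tuples_light _ k) B_sub.
rewrite [X in _ = X - _](big_setID [set [tuple of nseq k.+1 a] | a in A]) /=.
rewrite (setIidPr B_sub) -light_tuplesD.
rewrite big_imset /=; last first.
  by move=> a b _ _; apply: const_tuple_inj.
by rewrite [X in _ = X + _ - _](eq_bigr id) // addrAC subrr add0r.
Qed.

(** * The deleted loops and the final construction *)

Lemma exists_unit_removal (q : nat) (W : 'Z_q) : (2 < q)%N ->
  exists A : {set 'Z_q},
    [/\ forall a, a \in A -> centred_val a < 0,
        (#|A| <= if q == 6 then 2 else 1)%N
      & W - \sum_(a in A) a \is a GRing.unit].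
Proof.
move=> q_gt2; have q_gt1 := ltnW q_gt2.
have neg_nat a : (0 < a)%N -> (a.*2 < q)%N -> centred_val (a%:R : 'Z_q) < 0.
  move=> a_gt0 a_lt; rewrite centred_val_nat; last by lia.
  have : (a.*2%:R : rat) < q%:R by rewrite ltr_nat.
  rewrite -muln2 natrM; lra.
have single a v : (a.*2 < q)%N -> coprime q v ->
    (v + a = W \/ v + a = W + q)%N ->
    exists A : {set 'Z_q},
    [/\ forall a, a \in A -> centred_val a < 0, (#|A| <= 1)%N
      & W - \sum_(a in A) a \is a GRing.unit].
  move=> a_lt v_co def_v.
  have Wv : W - a%:R = v%:R.
    apply/eqP; rewrite subr_eq -natrD.
    have -> : (v + a)%:R = (W : nat)%:R :> 'Z_q.
      by case: def_v => ->; rewrite ?natrD ?pchar_Zp ?addr0.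
    by rewrite natr_Zp.
  have v_unit : (v%:R : 'Z_q) \is a GRing.unit by rewrite unitZpE.
  (* The zero tuple has weight zero and is not light, so [a = 0] stands for no deletion. *)
  have [a0|a_gt0] := posnP a.
    exists set0; split=> [b||]; rewrite ?inE ?cards0 // big_set0.
    by move: Wv; rewrite a0 => ->.
  exists [set a%:R]; split=> [b||]; rewrite ?cards1 ?big_set1 ?Wv //.
  by rewrite inE => /eqP->; apply: neg_nat.
have W_lt : (W < q)%N by have := ltn_ord W; rewrite {2}(Zp_cast q_gt1).
have [q6|q_neq6] := eqVneq q 6%N; last first.
  have [a [v [a_lt v_co def_v]]] := exists_coprime_shift q_gt2 q_neq6 W_lt.
  exact: single a_lt v_co def_v.
have weaken : (exists A : {set 'Z_q},
    [/\ forall a, a \in A -> centred_val a < 0, (#|A| <= 1)%N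
      & W - \sum_(a in A) a \is a GRing.unit]) -> exists A : {set 'Z_q},
    [/\ forall a, a \in A -> centred_val a < 0, (#|A| <= 2)%N
      & W - \sum_(a in A) a \is a GRing.unit].
  by case=> A [A_neg A_le A_unit]; exists A; split=> //; apply: leq_trans A_le _.
(* Modulo 6 the units are 1 and 5. From 4, deleting one of 1 and 2 leaves 3 or 2, but deleting both
   leaves 1. *)
have [W4|W_neq4] := eqVneq (W : nat) 4%N.
  have one_neq2 : (1%:R : 'Z_q) != 2%:R.
    apply/eqP => /(congr1 (@nat_of_ord _)).
    by rewrite !val_Zp_nat // !modn_small //; lia.
  exists [set 1%:R; 2%:R]; split=> [b||]; last first.
  - rewrite big_setU1 ?inE //= big_set1 -natrD -[W]natr_Zp W4 -natrB //.
    exact: unitr1.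
  - by rewrite cards2 one_neq2.
  by rewrite !inE => /orP[]/eqP->; apply: neg_nat; lia.
apply: weaken.
have [W0|W_gt0] := posnP (W : nat).
  by apply: (single 1%N 5%N); [lia | rewrite q6 | lia].
have [W_le3|W_gt3] := leqP (W : nat) 3.
  by apply: (single (W - 1)%N 1%N); [lia | rewrite coprimen1 | lia].
by apply: (single 0%N 5%N); [lia | rewrite q6 | lia].
Qed.

Theorem theorem5 (n q : nat) (hn : (2 < n)%N) (hq : (2 < q)%N) :
  exists (m : nat) (s : nat -> 'Z_q),
    orientable_sequence n m s /\
    q%:R * (q%:R ^+ (n - 1)
            - (num_pseudoweight q (n - 1) ((n - 1)%N%:R * q%:R / 2%:R))%:R
            - (if q == 6%N then 4%:R else 2%:R)) / 2%:R <= m%:R :> rat.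
Proof.
(* Here [n] is [k.+2], so the light tuples have length [k.+1], and [0 < k] serves their
   connectivity. *)
have [k def_n k_gt0] : exists2 k, n = k.+2 & (0 < k)%N by exists (n - 2)%N; lia.
have -> : (n - 1 = k.+1)%N by lia.
rewrite {}def_n {hn}.
set r := num_pseudoweight _ _ _.
have q_gt1 := ltnW hq.
have [A [A_neg A_card A_unit]] :=
  exists_unit_removal (\sum_(u in light_tuples k.+1 set0) thead u) hq.
rewrite -sum_light_tuples_removal // in A_unit.
set E := light_tuples k.+1 A in A_unit.
have E_neq0 : E != set0.
  by apply: contraTneq A_unit => ->; rewrite big_set0 unitr0.
have [t [t_win t_light t_sum]] := debruijn_sequence
  (light_tuples_rot1 A) (light_tuples_connected hq k_gt0) E_neq0.
exists (q * #|E|)%N, (fun i => \sum_(j < i) t j); split.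
  apply: lift_orientable => //; last by rewrite t_sum.
  move=> i j.
  have [/existsP[x tx]|] :=
      boolP [exists x : 'I_k.+1, t (i + x)%N != - t (j + (k.+1 - x.+1))%N].
    by exists x.
  (* One window would be the negated reverse of the other, so their weights would be opposite, yet
     both are negative. *)
  rewrite negb_exists => /forallP t_eq.
  have win_lt0 l : centred_weight (window k.+1 t l) < 0.
    by have := t_light l; rewrite inE => /and3P[].
  have := win_lt0 i; suff -> : centred_weight (window k.+1 t i)
      = - centred_weight (window k.+1 t j).
    by rewrite oppr_lt0 ltNge (ltW (win_lt0 j)).
  rewrite /centred_weight !big_tuple -sumrN (reindex_inj rev_ord_inj) /=.
  apply: eq_bigr => x _; rewrite !tnth_mktuple -centred_valN //; congr centred_val.
  have /negPn/eqP-> := t_eq (rev_ord x); congr (- t (_ + _)%N).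
  by rewrite /= -subSn ?subSS ?subKn // ltnW.
(* The two counts give 2|E| = q^(k+1) - r - 2|A|, and the bound on |A| yields the constants 2 and
   4. *)
have cardE := card_light_tuples_removal k A_neg.
have cardL := card_light_tuples0 k.+1 q_gt1.
rewrite -mulrA natrM ler_wpM2l // ler_pdivrMr //.
have -> : (q%:R : rat) ^+ k.+1 = 2%:R * (#|E|%:R + #|A|%:R) + r%:R.
  by rewrite -natrX -cardL -cardE natrD natrM natrD.
have : (#|A|%:R : rat) <= (if q == 6 then 2 else 1)%N%:R by rewrite ler_nat.
by case: (q == 6%N); lra.
Qed.
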